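(* Let $C \subset \mathbb{R}^n$ be convex, compact, with nonempty interior, and let $h \colon C \to \mathbb{R}$ be a Legendre function with domain $C$ that is continuous on $C$. Then: (i) Condition (A) holds if and only if $h$ is strictly convex on $C$; (ii) Condition (B) holds if and only if $C$ is a polytope. Here condition (A) is: for every sequence $(x_k)_{k\in\mathbb{N}} \subset \mathrm{int}\, C$ and every $y \in C$, if $D_h(y,x_k) \to 0$ as $k\to\infty$ then $x_k \to y$. Condition (B) is: for every sequence $(x_k)_{k\in\mathbb{N}} \subset \mathrm{int}\, C$ and every $y \in C$, if $x_k \to y$ as $k \to \infty$ then $D_h(y,x_k) \to 0$.
   Context: A convex function $h \colon C \to \mathbb{R}$ on a convex set $C\subset\mathbb{R}^n$ with nonempty interior is called Legendre if (1) it is essentially smooth: $h$ is continuously differentiable on $\mathrm{int}\, C$ and $\|\nabla h(x)\| \to +\infty$ whenever $x \in \mathrm{int}\, C$ approaches a point of the boundary of $C$; and (2) $h$ is strictly convex on $\mathrm{int}\, C$. The Bregman divergence of $h$ is defined for $y \in C$ and $x \in \mathrm{int}\, C$ by $D_h(y,x) = h(y) - h(x) - \langle \nabla h(x), y - x\rangle$. A polytope is the convex hull of finitely many points. *)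

(* Defs.v *)
From HB Require Import structures.
From mathcomp Require Import all_boot all_order all_algebra.
From mathcomp Require Import all_classical all_reals all_analysis.
Set Implicit Arguments. Unset Strict Implicit. Unset Printing Implicit Defensive.
Import Order.TTheory GRing.Theory Num.Theory.
Import numFieldNormedType.Exports.
Local Open Scope classical_set_scope.
Local Open Scope ring_scope.

Section Defs.
Variables (R : realType) (n : nat).
Notation V := 'rV[R]_n.

Definition convex_set_Rn (C : set V) : Prop :=
  forall x y (t : R), C x -> C y -> 0 <= t <= 1 -> C (t *: x + (1 - t) *: y).

Definition convex_on (A : set V) (h : V -> R) : Prop :=
  forall x y (t : R), A x -> A y -> 0 <= t <= 1 ->
    h (t *: x + (1 - t) *: y) <= t * h x + (1 - t) * h y.

Definition strictly_convex_on (A : set V) (h : V -> R) : Prop :=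
  forall x y (t : R), A x -> A y -> x != y -> 0 < t < 1 ->
    h (t *: x + (1 - t) *: y) < t * h x + (1 - t) * h y.

Definition grad (h : V -> R) (x : V) : V :=
  \row_(i < n) 'D_(delta_mx 0 i) h x.

Definition dotp (u v : V) : R := \sum_(i < n) u 0 i * v 0 i.
Definition enorm (u : V) : R := Num.sqrt (dotp u u).

Definition C1_on (A : set V) (h : V -> R) : Prop :=
  (forall x, A x -> differentiable h x) /\ {within A, continuous (grad h)}.

Definition essentially_smooth (C : set V) (h : V -> R) : Prop :=
  C1_on (interior C) h /\
  forall b : V, (closure C `\` interior C) b ->
    forall u : nat -> V, (forall k, interior C (u k)) -> u @ \oo --> b ->
      forall M : R, \forall k \near \oo, M < enorm (grad h (u k)).

Definition legendre (C : set V) (h : V -> R) : Prop :=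
  convex_on C h /\ essentially_smooth C h /\ strictly_convex_on (interior C) h.

Definition bregman (h : V -> R) (y x : V) : R :=
  h y - h x - dotp (grad h x) (y - x).

Definition conv_hull (s : seq V) : set V :=
  [set x | exists w : 'I_(size s) -> R,
     (forall i, 0 <= w i) /\ \sum_(i < size s) w i = 1 /\
     x = \sum_(i < size s) w i *: s`_i].
Definition polytope (C : set V) : Prop := exists s : seq V, C = conv_hull s.

Definition condA (C : set V) (h : V -> R) : Prop :=
  forall (x : nat -> V) (y : V), (forall k, interior C (x k)) -> C y ->
    (fun k => bregman h y (x k)) @ \oo --> 0 -> x @ \oo --> y.

Definition condB (C : set V) (h : V -> R) : Prop :=
  forall (x : nat -> V) (y : V), (forall k, interior C (x k)) -> C y ->
    x @ \oo --> y -> (fun k => bregman h y (x k)) @ \oo --> 0.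

End Defs.

(* Main.v *)
(* The tangent inequality at [x] tested at [(x + y) / 2] and at [2 x - y] gives
     h y + h x - 2 h ((x + y) / 2) <= D y x <= h y + h (2 x - y) - 2 h x,
   where [D y x] is the Bregman divergence.
   The lower bound and compactness give (A) from strict convexity. If [h] is not
   strictly convex at [z = t a + (1 - t) b], let [x_k] tend to [z] along a
   segment from the interior: the upper bound gives [D z x_k -> 0], and
   [t D a x_k + (1 - t) D b x_k <= D z x_k], contradicting (A) at [a].

   Call [C] locally conical if [2 x - y] is in [C] for all [x] in [C] close to
   [y]. A polytope is locally conical, and then the upper bound gives (B).
   Conversely, if [2 x - y] is not in [C], with [x] interior and close to [y],
   the ray from [y] through [x] exits [C] at some [z] close to [y]; by essential
   smoothness [D y] is unbounded on the segment from [x] to [z], so (B) fails at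
   [y]. Hence (B) makes [C] locally conical, thus a polytope: [C] is covered by
   finitely many of the neighborhoods of local conicity, and their centers
   span [C]. *)
Require Import Defs.
From HB Require Import structures.
From mathcomp Require Import all_boot all_order all_algebra.
From mathcomp Require Import all_classical all_reals all_analysis.
From mathcomp Require Import finmap ring lra.
Import Order.TTheory GRing.Theory Num.Theory.
Import numFieldNormedType.Exports.
Local Open Scope classical_set_scope.
Local Open Scope ring_scope.

Section Bregman.
Context {R : realType} {n : nat}.
Notation V := 'rV[R]_n.
Implicit Types (C : set V) (h : V -> R) (x y z : V) (s : seq V).

(** * Tangent inequality and bounds on the divergence *)

Lemma dotp_grad h x (v : V) : differentiable h x ->
  dotp (grad h x) v = 'd h x v.
Proof.
move=> dh; rewrite [in RHS](row_sum_delta v) linear_sum.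
by apply: eq_bigr => i _; rewrite linearZ mxE deriveE // mulrC.
Qed.

Lemma bregmanE h y x : differentiable h x ->
  bregman h y x = h y - h x - 'd h x (y - x).
Proof. by move=> dh; rewrite /bregman dotp_grad. Qed.

(** By convexity the difference quotient of [h] at [x] along [y - x] is at most [h y - h x] for
    every step in [(0, 1]]; let the step tend to [0] from the right. *)
Lemma tangent_le C h x y : convex_on C h -> differentiable h x ->
  C x -> C y -> 'd h x (y - x) <= h y - h x.
Proof.
move=> ch dh Cx Cy; rewrite -deriveE //.
have dq : (fun t : R => t^-1 *: ((h \o shift x) (t *: (y - x)) - h x))
    @ 0^'+ --> 'D_(y - x) h x.
  by apply: cvg_dnbhs_at_right; exact: (diff_derivable dh).
apply: (closed_cvg (fun z : R => z <= h y - h x) _ _ _ dq).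
  exact: closed_le.
near=> t; rewrite -[_ *: _]/(t^-1 * _).
have t0 : 0 < t by near: t; exact: nbhs_right_gt.
have t1 : t <= 1 by near: t; apply: nbhs_right_le.
rewrite mulrC ler_pdivrMr //.
have -> : (h \o shift x) (t *: (y - x)) = h (t *: y + (1 - t) *: x).
  by congr h; rewrite /= scalerBr scalerBl scale1r -addrA [- _ + _]addrC.
have := ch y x t Cy Cx; rewrite (ltW t0) t1 => /(_ isT); lra.
Unshelve. all: by end_near. Qed.

Lemma bregman_ge_mid C h x y : convex_on C h -> differentiable h x ->
  C x -> C (2^-1 *: (x + y)) ->
  h y + h x - 2 * h (2^-1 *: (x + y)) <= bregman h y x.
Proof.
move=> ch dh Cx Cm; rewrite bregmanE //.
have := tangent_le C h x _ ch dh Cx Cm.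
have -> : 2^-1 *: (x + y) - x = 2^-1 *: (y - x).
  by apply/rowP => i; rewrite !mxE; lra.
have -> : 'd h x (2^-1 *: (y - x)) = 2^-1 * 'd h x (y - x) by rewrite linearZ.
lra.
Qed.

Lemma bregman_ge0 C h x y : convex_on C h -> differentiable h x ->
  C x -> C y -> 0 <= bregman h y x.
Proof.
by move=> ch dh Cx Cy; rewrite bregmanE // subr_ge0; exact: tangent_le ch _ _ _.
Qed.

Lemma bregman_le_refl C h x y : convex_on C h -> differentiable h x ->
  C x -> C (2 *: x - y) ->
  bregman h y x <= h y + h (2 *: x - y) - 2 * h x.
Proof.
move=> ch dh Cx Cm; rewrite bregmanE //.
have := tangent_le C h x _ ch dh Cx Cm.
have -> : 2 *: x - y - x = - (y - x).
  by apply/rowP => i; rewrite !mxE; lra.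
rewrite linearN /=; lra.
Qed.

(** * Approaching a point of [C] from the interior *)

Lemma interior_segment C c z (t : R) : convex_set_Rn C -> C° c -> C z ->
  0 < t <= 1 -> C° (t *: c + (1 - t) *: z).
Proof.
move=> cC /nbhs_ballP[e /= e0 ballC] Cz /andP[t0 t1].
apply/nbhs_ballP; exists (t * e) => /=; first exact: mulr_gt0.
move=> w; rewrite -ball_normE /= => dw.
set p := t *: c + _ in dw.
(* As [w] is within [t * e] of [p], the point [c + t^-1 (w - p)] is within [e] of [c], hence in
   [C]. *)
have -> : w = t *: (c + t^-1 *: (w - p)) + (1 - t) *: z.
  rewrite scalerDr scalerA mulfV ?gt_eqF // scale1r addrAC -/p.
  by rewrite addrC subrK.
apply: cC => //; last by rewrite (ltW t0).
apply: ballC; rewrite -ball_normE /= opprD addrA subrr sub0r normrN normrZ.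
by rewrite gtr0_norm ?invr_gt0 // mulrC ltr_pdivrMr // mulrC -normrN opprB.
Qed.

(** Stated for any filter: it serves both for sequences and for the filters [within K (nbhs z)]. *)
Lemma cvg_comp_within {T : Type} {F : set_system T} {FF : Filter F}
    C h (u : T -> V) y :
  {within C, continuous h} -> (\forall k \near F, C (u k)) -> C y ->
  u @ F --> y -> h (u k) @[k --> F] --> h y.
Proof.
move=> hc Cu Cy uy; have := hc y; rewrite /continuous_at /= => hy.
apply: cvg_trans hy => A /= hA.
move: hA; rewrite /nbhs /= -nbhs_subspace_in // => hA.
have := uy _ hA; rewrite /nbhs /= => H.
by near=> k; near: k; apply: filterS2 Cu H => k Ck; apply.
Unshelve. all: by end_near. Qed.

Lemma bounded_within C h : compact C -> {within C, continuous h} ->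
  exists2 H, 0 <= H & forall x, C x -> `|h x| <= H.
Proof.
move=> kC hc; have /compact_bounded[M [_ MB]] := continuous_compact hc kC.
exists (`|M| + 1); first by rewrite addr_ge0.
move=> x Cx; apply: MB; last by exists x.
by rewrite (le_lt_trans (ler_norm M)) // ltrDl.
Qed.

(** The factor [2^-1] keeps twice the weight at most [1], so that the reflected point in
    [approach_reflect] is still a convex combination of [c] and [z]. *)
Definition half_harmonic (k : nat) : R := 2^-1 * harmonic k.

Lemma half_harmonic_gt0 k : 0 < half_harmonic k.
Proof. by rewrite mulr_gt0 // ?invr_gt0. Qed.

Lemma half_harmonic_le k : half_harmonic k <= 2^-1.
Proof. by rewrite ler_piMr // invf_le1 // ler1n. Qed.

Lemma cvg_half_harmonic : half_harmonic k @[k --> \oo] --> (0 : R).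
Proof. by rewrite -[0](mulr0 2^-1); apply: cvgMr; exact: cvg_harmonic. Qed.

Definition approach (c z : V) (k : nat) : V :=
  half_harmonic k *: c + (1 - half_harmonic k) *: z.

Lemma cvg_approach c z : approach c z @ \oo --> z.
Proof.
have : approach c z @ \oo --> 0 *: c + (1 - 0) *: z.
  apply: cvgD; first by apply: cvgZr_tmp; exact: cvg_half_harmonic.
  by apply: cvgZr_tmp; apply: cvgB; [exact: cvg_cst|exact: cvg_half_harmonic].
by rewrite scale0r add0r subr0 scale1r.
Qed.

Lemma interior_approach C c z k :
  convex_set_Rn C -> C° c -> C z -> C° (approach c z k).
Proof.
move=> cC Cc Cz; apply: interior_segment => //.
have := half_harmonic_le k; have := half_harmonic_gt0 k; lra.
Qed.

Lemma approach_reflect C c z k :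
  convex_set_Rn C -> C c -> C z -> C (2 *: approach c z k - z).
Proof.
move=> cC Cc Cz.
have -> : 2 *: approach c z k - z =
    (2 * half_harmonic k) *: c + (1 - 2 * half_harmonic k) *: z.
  by apply/rowP => i; rewrite !mxE; ring.
apply: cC => //.
have := half_harmonic_le k; have := half_harmonic_gt0 k; lra.
Qed.

(** The reflections [2 x_k - y] also tend to [y], so the bound of [bregman_le_refl] tends to
    [h y + h y - 2 h y = 0]. *)
Lemma bregman_cvg0 C h (x : nat -> V) y :
  convex_on C h -> (forall z, C° z -> differentiable h z) ->
  {within C, continuous h} -> (forall k, C° (x k)) -> C y -> x @ \oo --> y ->
  (\forall k \near \oo, C (2 *: x k - y)) ->
  bregman h y (x k) @[k --> \oo] --> 0.
Proof.
move=> ch dh hc Cx Cy xy Crefl.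
have Cx' k : C (x k) by exact: interior_subset.
have dx k : differentiable h (x k) by exact: dh.
have hx : h (x k) @[k --> \oo] --> h y.
  by apply: (cvg_comp_within C h x) => //; exact: nearW.
have hr : h (2 *: x k - y) @[k --> \oo] --> h y.
  apply: (cvg_comp_within C h (fun k => 2 *: x k - y)) => //.
  have : 2 *: x k - y @[k --> \oo] --> 2 *: y - y.
    by apply: cvgB; [exact: cvgZl_tmp|exact: cvg_cst].
  by rewrite scalerDl !scale1r addrK.
have up : h y + h (2 *: x k - y) - 2 * h (x k) @[k --> \oo] --> 0.
  have -> : 0 = h y + h y - 2 * h y by ring.
  apply: cvgB; last exact: cvgMr.
  by apply: cvgD => //; exact: cvg_cst.
apply: (@squeeze_cvgr _ _ _ _ (fun=> 0) _ _ _ _ (cvg_cst _) up).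
near=> k; apply/andP; split.
  exact: (bregman_ge0 C).
by apply: (bregman_le_refl C) => //; near: k.
Unshelve. all: by end_near. Qed.

(** * Condition (A) and strict convexity *)

Lemma condA_strictly_convex C h : convex_set_Rn C -> C° !=set0 ->
  convex_on C h -> (forall z, C° z -> differentiable h z) ->
  {within C, continuous h} -> condA C h -> strictly_convex_on C h.
Proof.
move=> cC [c Cc] ch dh hc A a b t Ca Cb ab t01.
have t01' : 0 <= t <= 1 by lra.
rewrite ltNge; apply/negP => hle.
set z := t *: a + (1 - t) *: b in hle.
have Cz : C z by exact: cC.
pose x := approach c z.
have Cx k : C° (x k) by exact: interior_approach.
have Cx' k : C (x k) by exact: interior_subset.
have dx k : differentiable h (x k) by exact: dh.
have xz : x @ \oo --> z by exact: cvg_approach.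
have Dz : bregman h z (x k) @[k --> \oo] --> 0.
  apply: (bregman_cvg0 C) => //; apply: nearW => k.
  by apply: approach_reflect => //; exact: interior_subset.
(* The linear terms cancel in [D z x_k - t D a x_k - (1 - t) D b x_k], leaving
   [h z - t h a - (1 - t) h b], which is nonnegative by [hle]. *)
have Da : bregman h a (x k) @[k --> \oo] --> 0.
  apply: (@squeeze_cvgr _ _ _ _ (fun=> 0) (fun k => t^-1 * bregman h z (x k)));
    [|exact: cvg_cst|by rewrite -[0](mulr0 t^-1); exact: cvgMr].
  apply: nearW => k; rewrite (bregman_ge0 C) //=.
  rewrite mulrC ler_pdivlMr; last by lra.
  have Db0 : 0 <= bregman h b (x k) by exact: (bregman_ge0 C).
  have : (1 - t) * bregman h b (x k) >= 0 by apply: mulr_ge0 => //; lra.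
  rewrite !bregmanE //.
  have -> : z - x k = t *: (a - x k) + (1 - t) *: (b - x k).
    by apply/rowP => i; rewrite !mxE; ring.
  have -> (v w : V) : 'd h (x k) (t *: v + (1 - t) *: w) =
      t * 'd h (x k) v + (1 - t) * 'd h (x k) w by rewrite linearD !linearZ.
  lra.
have xa := A x a Cx Ca Da.
have zaE : z = a by exact: (cvg_unique _ xz xa).
have : (1 - t) *: (b - a) = 0.
  by rewrite -[RHS](subrr a) -{2}zaE; apply/rowP => i; rewrite !mxE; ring.
move/eqP; rewrite scaler_eq0 !subr_eq0 => /orP[/eqP|/eqP ba]; first by lra.
by rewrite ba eqxx in ab.
Qed.

Lemma strictly_convex_condA C h : convex_set_Rn C -> compact C ->
  convex_on C h -> (forall z, C° z -> differentiable h z) ->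
  {within C, continuous h} -> strictly_convex_on C h -> condA C h.
Proof.
move=> cC kC ch dh hc sh x y Cx Cy Dx.
have Cx' k : C (x k) by exact: interior_subset.
have dx k : differentiable h (x k) by exact: dh.
pose m z := 2^-1 *: (z + y).
have Cm z : C z -> C (m z).
  move=> Cz; rewrite /m.
  have -> : 2^-1 *: (z + y) = 2^-1 *: z + (1 - 2^-1) *: y.
    by apply/rowP => i; rewrite !mxE; lra.
  by apply: cC => //; lra.
pose gap z := h y + h z - 2 * h (m z).
move=> A /nbhs_ballP[e /= e0 eA].
change (\forall k \near \oo, A (x k)).
(* On [K] the continuous function [gap] has a minimum, positive by strict convexity. Since
   [gap (x k)] is at most the divergence, which tends to [0], [x k] eventually leaves [K]. *)
pose K := C `&` ~` ball y e.
have kK : compact K.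
  apply: (subclosed_compact _ kC); last by move=> z [].
  by apply: closedI; [exact: compact_closed|exact/open_closedC/ball_open].
have [K0|/set0P K0] := eqVneq K set0.
  apply: nearW => k; apply: eA; apply: contrapT => nb.
  by have : K (x k) by []; rewrite K0.
have gc : {within K, continuous gap}.
  apply/subspace_continuousP => z [Cz _].
  have zz : z0 @[z0 --> within K (nbhs z)] --> z by exact: cvg_within_filter.
  have zK : \forall z0 \near within K (nbhs z), C z0.
    by apply: filterS (withinT _ _) => z0 [].
  apply: cvgB.
    by apply: cvgD; [exact: cvg_cst|exact: (cvg_comp_within C h id)].
  apply: cvgMr; apply: (cvg_comp_within C h m) => //.
    by apply: filterS zK => z0; exact: Cm.
    exact: Cm.
  apply: (@cvgZl_tmp _ _ _ _ _ 2^-1 (fun z0 => z0 + y)).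
  by apply: cvgD => //; exact: cvg_cst.
have [c cK minc] := compact_EVT_min K0 kK gc.
have [Cc nbc] : K c by exact: set_mem.
have cy : c != y by apply/eqP => cy; apply: nbc; rewrite cy; exact: ballxx.
have gap_gt0 : 0 < gap c.
  have := sh c y 2^-1 Cc Cy cy.
  have -> : 2^-1 *: c + (1 - 2^-1) *: y = m c.
    by apply/rowP => i; rewrite !mxE; lra.
  have h2 : 0 < (2^-1 : R) < 1 by lra.
  move=> /(_ h2); rewrite /gap; lra.
near=> k.
have Dk : bregman h y (x k) < gap c by near: k; exact: (cvgr_lt _ Dx).
apply: eA; apply: contrapT => nb.
have Kx : x k \in K by exact: mem_set.
have := minc _ Kx.
have : gap (x k) <= bregman h y (x k).
  by apply: (bregman_ge_mid C) => //; exact: Cm.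
lra.
Unshelve. all: by end_near. Qed.

(** * Local conicity implies condition (B) *)

Definition locally_conical C :=
  forall y, C y -> \forall x \near y, C x -> C (2 *: x - y).

Lemma locally_conical_condB C h :
  convex_on C h -> (forall z, C° z -> differentiable h z) ->
  {within C, continuous h} -> locally_conical C -> condB C h.
Proof.
move=> ch dh hc lC x y Cx Cy xy; apply: (bregman_cvg0 C) => //.
near=> k.
have lk : C (x k) -> C (2 *: x k - y) by near: k; exact: (xy _ (lC y Cy)).
by apply: lk; exact: interior_subset.
Unshelve. all: by end_near. Qed.

(** * Polytopes and local conicity *)

Definition simplex (m : nat) : set 'rV[R]_m :=
  [set w | (forall i, 0 <= w 0 i) /\ \sum_i w 0 i = 1].

Definition combine s (w : 'rV[R]_(size s)) : V := \sum_i w 0 i *: s`_i.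

(** With row vectors as weights, the hull is the image of a compact set under a continuous linear
    map. *)
Lemma conv_hullE s : conv_hull s = combine s @` simplex (size s).
Proof.
apply/seteqP; split=> x /=.
  move=> [w [w0 [w1 ->]]]; exists (\row_i w i).
    by split; [move=> i; rewrite mxE|under eq_bigr do rewrite mxE].
  by apply: eq_bigr => i _; rewrite mxE.
by move=> [w [w0 w1] <-]; exists (w 0).
Qed.

Lemma combineD s w1 w2 : combine s (w1 + w2) = combine s w1 + combine s w2.
Proof.
by rewrite -big_split; apply: eq_bigr => i _; rewrite mxE scalerDl.
Qed.

Lemma combineZ s a w : combine s (a *: w) = a *: combine s w.
Proof. by rewrite scaler_sumr; apply: eq_bigr => i _; rewrite mxE scalerA. Qed.

Lemma continuous_sum_coord m : continuous (fun w : 'rV[R]_m => \sum_i w 0 i).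
Proof.
apply: (@continuous_big _ _ _ _ xpredT add_continuous) => i _.
exact: coord_continuous.
Qed.

Lemma continuous_combine s : continuous (combine s).
Proof.
apply: (@continuous_big _ _ _ _ xpredT add_continuous) => i _ w.
have cw : (u : 'rV[R]_(size s)) 0 i @[u --> w] --> w 0 i.
  exact: coord_continuous.
exact: cvgZr_tmp cw.
Qed.

Lemma compact_simplex m : compact (simplex m).
Proof.
apply: bounded_closed_compact.
  exists 1; split => // M M1 w [w0 w1] /=.
  apply: (le_trans _ (ltW M1)); have -> : `|w| = mx_norm w by [].
  rewrite mx_normrE.
  apply: bigmax_le => // -[i j] _ /=; rewrite ord1 ger0_norm //.
  by rewrite -w1 (bigD1 j) //= lerDl sumr_ge0.
have -> : simplex m =
    \bigcap_i ((fun w : 'rV[R]_m => w 0 i) @^-1` [set a | 0 <= a])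
    `&` (fun w : 'rV[R]_m => \sum_i w 0 i) @^-1` [set a | a = 1].
  apply/seteqP; split=> w [w0 w1]; split => // i; first by move=> _; exact: w0.
  exact: w0.
apply: closedI.
  apply: closed_bigI => i _; apply: preimage_closed; last exact: closed_ge.
  by move=> w _; exact: coord_continuous.
apply: preimage_closed; last exact: closed_eq.
by move=> w _; exact: continuous_sum_coord.
Qed.

Lemma convex_conv_hull s : convex_set_Rn (conv_hull s).
Proof.
move=> x y t; rewrite conv_hullE => -[v [v0 v1] <-] [w [w0 w1] <-] t01.
exists (t *: v + (1 - t) *: w); last by rewrite combineD !combineZ.
split=> [i|].
  by rewrite !mxE addr_ge0 // mulr_ge0 //; [lra|lra].
under eq_bigr do rewrite !mxE.
by rewrite big_split /= -!mulr_sumr v1 w1; ring.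
Qed.

Lemma mem_conv_hull s x : x \in s -> conv_hull s x.
Proof.
move=> xs; have xi : (index x s < size s)%N by rewrite index_mem.
exists (fun i => (i == Ordinal xi)%:R); split=> [i|]; first by rewrite ler0n.
split.
  rewrite (bigD1 (Ordinal xi)) //= eqxx big1 ?addr0 // => i /negPf ->.
  by [].
rewrite (bigD1 (Ordinal xi)) //= eqxx big1 ?addr0 => [|i /negPf ->].
  by rewrite scale1r nth_index.
by rewrite scale0r.
Qed.

Lemma closed_conv_hull s : closed (conv_hull s).
Proof.
rewrite conv_hullE; apply: compact_closed; first exact: norm_hausdorff.
apply: continuous_compact; last exact: compact_simplex.
by apply: continuous_subspaceT => w; exact: continuous_combine.
Qed.

(** Dividing by the total weight lets the induction use only binary combinations, of [v i] with the
    normalized tail. A tail of total weight [0] cannot be normalized, but then all its terms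
    vanish. *)
Lemma convex_sum_mem C (I : eqType) (r : seq I) (w : I -> R) (v : I -> V) :
  convex_set_Rn C -> (forall i, 0 <= w i) -> (forall i, C (v i)) ->
  0 < \sum_(i <- r) w i ->
  C ((\sum_(i <- r) w i)^-1 *: \sum_(i <- r) w i *: v i).
Proof.
move=> cC w0 Cv; elim: r => [|i r IH]; first by rewrite big_nil ltxx.
rewrite !big_cons; set W := \sum_(j <- r) w j; set S := \sum_(j <- r) _.
have W0 : 0 <= W by exact: sumr_ge0.
move=> wW; have [Wz|Wn0] := eqVneq W 0.
  have S0 : S = 0.
    move/eqP: Wz; rewrite /W psumr_eq0 // => /allP wr.
    by apply: big1_seq => j /= /wr /eqP ->; rewrite scale0r.
  move: wW; rewrite Wz S0 !addr0 => wi.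
  by rewrite scalerA mulVf ?scale1r // gt_eqF.
have Wgt0 : 0 < W by rewrite lt_def Wn0.
have -> : (w i + W)^-1 *: (w i *: v i + S) =
    (w i / (w i + W)) *: v i + (1 - w i / (w i + W)) *: (W^-1 *: S).
  rewrite scalerDr !scalerA [w i / _]mulrC; congr (_ + _ *: _).
  by field; rewrite !gt_eqF.
apply: cC => //; first exact: IH.
rewrite divr_ge0 //=; last exact: ltW.
by rewrite ler_pdivrMr // mul1r lerDl.
Qed.

Lemma conv_hull_sub C s : convex_set_Rn C -> {in s, forall x, C x} ->
  conv_hull s `<=` C.
Proof.
move=> cC Cs x [w [w0 [w1 ->]]].
rewrite -[X in C X]scale1r -[1]invr1 -w1.
by apply: convex_sum_mem => // [i|]; [apply: Cs; exact: mem_nth|rewrite w1].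
Qed.

(* If [w] represents [x] close to [y], compactness of the simplex provides a
   representation [a] of [y] close to [w]; then [2 w - a] has nonnegative
   entries and represents [2 x - y]. *)
Lemma polytope_locally_conical C : polytope C -> locally_conical C.
Proof.
move=> [s ->] y _.
(* Compactness reduces a claim about all weights [w], for [x] near [y], to weights near a given [a].
   If [a] does not represent [y], then no [w] near [a] represents an [x] near [y], and the claim is
   vacuous. *)
have /compact_near_coveringP near_simplex := compact_simplex (size s).
have := near_simplex V (nbhs y) (fun x w => simplex (size s) w ->
  combine s w = x -> conv_hull s (2 *: x - y)).
suff near_reflect a : simplex (size s) a ->
    \forall w \near a & x \near y, simplex (size s) w ->
      combine s w = x -> conv_hull s (2 *: x - y).
  move=> /(_ _ near_reflect); apply: filterS => x near_x.
  by rewrite {1}conv_hullE => -[w sw wx]; exact: (near_x w).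
move=> [a0 a1]; have [ay|ay] := eqVneq (combine s a) y; last first.
  have cpair : combine s p.1 - p.2 @[p --> (a, y)] --> combine s a - y.
    apply: cvgB; last exact: cvg_snd.
    apply: cvg_comp; last exact: continuous_combine.
    exact: cvg_fst.
  have /cvgr_neq0 := cpair; rewrite subr_eq0 => /(_ ay).
  by apply: filterS => -[w x] /= + _ wx; rewrite wx subrr eqxx.
(* A positive [a 0 i] exceeds its half, hence so does [w 0 i] for [w] near [a]; if [a 0 i = 0], then
   [0 <= w 0 i] is enough. *)
pose B i (w : 'rV[R]_(size s)) := a 0 i <= 2 * w 0 i \/ a 0 i = 0.
have near_a : \forall w \near a, forall i, B i w.
  apply: (@filter_forall _ _ B (nbhs a)) => i; rewrite /B.
  have [ai0|ai0] := eqVneq (a 0 i) 0.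
    by apply: nearW => w; right.
  have ai : a 0 i / 2 < a 0 i by have := a0 i; lra.
  have ca : (w : 'rV[R]_(size s)) 0 i @[w --> a] --> a 0 i.
    exact: coord_continuous.
  near=> w; left; rewrite mulrC -ler_pdivrMr //; apply/ltW; near: w.
  exact: (cvgr_gt _ ca).
near=> w x => /= -[w0 w1] <-.
rewrite conv_hullE; exists (2 *: w - a).
  split=> [i|].
    have : B i w by move: i; near: w.
    by rewrite /B !mxE; have := w0 i; lra.
  under eq_bigr do rewrite !mxE.
  by rewrite sumrB -mulr_sumr w1 a1; ring.
by rewrite combineD combineZ -scaleN1r combineZ scaleN1r ay.
Unshelve. all: by end_near. Qed.

(* By compactness every [x] in [C] is the midpoint of one of finitely many
   points of [C] and of a further point of [C], so passing to the further point
   doubles the distance to the convex hull of these finitely many points. *)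
Lemma locally_conical_polytope C : convex_set_Rn C -> compact C ->
  locally_conical C -> polytope C.
Proof.
move=> cC kC lC.
pose U y : set V := [set x | C x -> C (2 *: x - y)].
have [D DC CD] : finite_subset_cover C (fun y => (U y)°) C.
  move: (kC); rewrite compact_cover; apply.
    by move=> y _; exact: open_interior.
  by move=> x Cx; exists x => //; exact: lC.
exists (enum_fset D); apply/seteqP; split; last first.
  by apply: conv_hull_sub => // x xD; exact/set_mem/DC.
have [N NC] : exists N, forall x, C x -> `|x| <= N.
  have [M [_ MC]] := compact_bounded kC.
  exists (`|M| + 1) => x; apply: MC.
  by rewrite (le_lt_trans (ler_norm M)) // ltrDl.
(* [2 * N] bounds the diameter of [C]. If [p] approximates [2 x - y], the midpoint of [p] and the
   center [y] approximates [x] with half the error. *)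
have dist k x : C x ->
    exists2 p, conv_hull (enum_fset D) p & `|x - p| <= 2 * N / 2 ^+ k.
  elim: k x => [|k IH] x Cx; have [y yD Uy] := CD x Cx.
    exists y; first exact: mem_conv_hull.
    have Cy : C y by exact/set_mem/DC.
    rewrite expr0 divr1 (le_trans (ler_normB _ _)) //.
    by have := NC _ Cx; have := NC _ Cy; lra.
  have Cx' : C (2 *: x - y) by exact: (interior_subset Uy).
  have [p hp xp] := IH _ Cx'.
  exists (2^-1 *: p + (1 - 2^-1) *: y).
    by apply: convex_conv_hull => //; [exact: mem_conv_hull|lra].
  have -> : x - (2^-1 *: p + (1 - 2^-1) *: y) = 2^-1 *: (2 *: x - y - p).
    by apply/rowP => i; rewrite !mxE; lra.
  rewrite normrZ ger0_norm ?invr_ge0 // exprS invfM mulrCA.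
  by rewrite ler_pM2l // invr_gt0.
move=> x Cx.
have /choice[p hp] : forall k, exists p, conv_hull (enum_fset D) p /\
    `|x - p| <= 2 * N / 2 ^+ k.
  by move=> k; have [q hq xq] := dist k x Cx; exists q.
have px : p @ \oo --> x.
  apply/cvgrPdist_le => e e0.
  have : (2 * N) * (2^-1 : R) ^+ k @[k --> \oo] --> (2 * N) * 0.
    apply: cvgMr; apply: cvg_expr; rewrite ger0_norm; lra.
  rewrite mulr0 => /cvgrPdist_le /(_ _ e0); apply: filterS => k.
  rewrite sub0r normrN => ke; apply: (le_trans (hp k).2).
  by apply: le_trans ke; rewrite exprVn ler_norm.
apply: (closed_cvg _ (closed_conv_hull _) _ _ px).
by apply: nearW => k; exact: (hp k).1.
Qed.

(** * Condition (B) implies local conicity *)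

Lemma norm_delta_mx_le1 (i : 'I_n) : `|delta_mx 0 i : V| <= 1.
Proof.
have -> : `|delta_mx 0 i : V| = mx_norm (delta_mx 0 i : V) by [].
rewrite mx_normrE; apply: bigmax_le => // -[j k] _ /=.
by rewrite mxE; case: (_ && _); rewrite ?normr1 ?normr0.
Qed.

Lemma enorm_le (u : V) (b : R) : (forall i, `|u 0 i| <= b) ->
  enorm u <= Num.sqrt (n%:R * b ^+ 2).
Proof.
move=> ub; apply: ler_wsqrtr.
rewrite /dotp mulr_natl -[n in _ *+ n]card_ord -sumr_const.
apply: ler_sum => i _; rewrite -expr2 -real_normK ?num_real //.
by rewrite lerXn2r // nnegrE // (le_trans _ (ub i)).
Qed.

(* Each partial derivative is bounded by the tangent inequality at [x] tested at
   the points [c + r e_i] and [c - r e_i]. *)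
Lemma grad_bound C h (H M r : R) c x : convex_on C h ->
  differentiable h x -> C x -> (forall z, C z -> `|h z| <= H) ->
  0 < r -> (forall v : V, `|v| <= r -> C (c + v)) -> 'd h x (x - c) <= M ->
  enorm (grad h x) <= Num.sqrt (n%:R * ((2 * H + M) / r) ^+ 2).
Proof.
move=> ch dh Cx hH r0 ballC hM; apply: enorm_le => i.
have bound (v : V) : `|v| <= r -> 'd h x v <= 2 * H + M.
  move=> vr; have Cv := ballC v vr.
  have := tangent_le _ _ _ _ ch dh Cx Cv.
  have -> : c + v - x = v - (x - c) by rewrite opprB addrCA addrA.
  rewrite linearB /=.
  by have := hH _ Cx; have := hH _ Cv; rewrite !ler_norml; lra.
have rd : `|r *: delta_mx 0 i : V| <= r.
  by rewrite normrZ gtr0_norm // ler_piMr ?norm_delta_mx_le1 // ltW.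
have dr : 'd h x (r *: delta_mx 0 i) = r * 'd h x (delta_mx 0 i).
  by rewrite linearZ.
rewrite mxE deriveE // ler_pdivlMr // mulrC -[X in X * _](gtr0_norm r0).
rewrite -normrM -dr ler_norml bound // andbT lerNl -linearN.
by apply: bound; rewrite normrN.
Qed.

(** Let [x = a y + (1 - a) z]. If the divergence is at most [1] at [w] between [x] and [z], the
    derivative at [w] along [w - y] is at most [1 + 2 H]. So is the one along [w - x], and
    [grad_bound] centered at [x] then contradicts steepness at [z]. *)
Lemma bregman_gt1_approach C h y z (a : R) : convex_set_Rn C -> compact C ->
  convex_on C h -> essentially_smooth C h -> {within C, continuous h} ->
  C y -> C z -> ~ C° z -> 0 <= a <= 1 -> C° (a *: y + (1 - a) *: z) ->
  \forall k \near \oo, 1 < bregman h y (approach (a *: y + (1 - a) *: z) z k).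
Proof.
move=> cC kC ch [[dh _] steep] hc Cy Cz nCz a01 Cx.
set x := a *: y + _ in Cx *.
have [H H0 hH] := bounded_within _ _ kC hc.
have /nbhs_ballP[e /= e0 eC] := Cx.
have e20 : 0 < e / 2 by exact: divr_gt0.
have ballC (v : V) : `|v| <= e / 2 -> C (x + v).
  move=> ve; apply: eC; rewrite -ball_normE /= opprD addrA subrr sub0r normrN.
  by rewrite (le_lt_trans ve) // ltr_pdivrMr // ltr_pMr // ltr1n.
have Cu k : C° (approach x z k) by exact: interior_approach.
have bz : (closure C `\` C°) z by split => //; exact: subset_closure.
have := steep z bz (approach x z) Cu (cvg_approach _ _)
  (Num.sqrt (n%:R * ((2 * H + (1 + 2 * H)) / (e / 2)) ^+ 2)).
apply: filterS => k; apply: contraTT; rewrite -!leNgt => D1.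
have Cw : C (approach x z k) by exact: interior_subset.
have dw : differentiable h (approach x z k) by exact: dh.
apply: (grad_bound C h H _ _ x) => //.
pose t : R := half_harmonic k.
have t0 : 0 < t by exact: half_harmonic_gt0.
have t1 : t <= 2^-1 by exact: half_harmonic_le.
move: D1; rewrite bregmanE //.
set w := approach x z k in Cw dw *.
(* [w - y] and [w - x] are nonnegative multiples of [z - y], the second being the shorter; only a
   positive [g] needs this comparison. *)
have -> : y - w = - (1 - t * a) *: (z - y).
  by rewrite /w /approach -/t /x; apply/rowP => i; rewrite !mxE; ring.
have -> : w - x = ((1 - t) * a) *: (z - y).
  by rewrite /w /approach -/t /x; apply/rowP => i; rewrite !mxE; ring.
have dZ (b : R) (v : V) : 'd h w (b *: v) = b * 'd h w v by rewrite linearZ.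
rewrite !dZ; set g := 'd h w _.
have /andP[a0 a1] := a01.
have := hH _ Cw; have := hH _ Cy; rewrite !ler_norml => hy hw D1.
have [g0|g0] := leP g 0.
  have : (1 - t) * a * g <= 0 by apply: mulr_ge0_le0 => //; apply: mulr_ge0; lra.
  lra.
have ta : t * a <= t by rewrite ler_piMr // ltW.
have : (1 - t) * a * g <= (1 - t * a) * g by rewrite ler_pM2r //; lra.
lra.
Qed.

(** Take the largest [tau] in [[1, 2]] with [y + tau (x - y)] in [C]. It is less than [2], so an
    interior point there would allow a larger [tau]. *)
Lemma exit_point C x y : compact C -> ~ C (2 *: x - y) -> C° x ->
  exists z (a : R), [/\ C z, ~ C° z, 0 <= a <= 1, x = a *: y + (1 - a) *: z
    & `|z - y| <= 2 * `|x - y|].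
Proof.
move=> kC nC Cxi; have Cx : C x by exact: interior_subset.
pose f (t : R) : V := y + t *: (x - y).
have fc : continuous f.
  move=> t; apply: cvgD; first exact: cvg_cst.
  by apply: cvgZr_tmp; exact: cvg_id.
pose T := `[1, 2] `&` f @^-1` C.
have kT : compact T.
  apply: (subclosed_compact _ (@segment_compact R 1 2)); last by move=> t [].
  apply: closedI; first exact: itv_closed.
  apply: preimage_closed; first by move=> t _; exact: fc.
  exact: compact_closed.
have f1 : f 1 = x by rewrite /f scale1r addrC subrK.
have f2 : f 2 = 2 *: x - y by apply/rowP => i; rewrite !mxE; ring.
have T0 : T !=set0.
  by exists 1; split; rewrite /= ?in_itv /= ?lexx ?ler1n // f1.
have [tau tauT maxT] := compact_EVT_max T0 kT
  (continuous_subspaceT (fun t => @cvg_id _ (nbhs t))).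
have [+ Ctau] : T tau by exact: set_mem.
rewrite /= in_itv /= => /andP[tau1 tau2].
have tau_lt2 : tau < 2.
  rewrite lt_neqAle tau2 andbT; apply/eqP => tauE.
  by apply: nC; rewrite -f2 -tauE.
have nCtau : ~ C° (f tau).
  move=> Ci; have nT : \forall t \near tau, C (f t) by exact: (fc tau).
  have : \forall t \near tau^'+, False.
    near=> t.
    have tt : tau < t by near: t; exact: nbhs_right_gt.
    have : t \in T.
      apply/mem_set; split; rewrite /= ?in_itv /=.
        rewrite (le_trans tau1) ?(ltW tt) //=.
        by near: t; exact: nbhs_right_le.
      by near: t; apply: cvg_within.
    by move=> /maxT; rewrite leNgt tt.
  by move=> /filter_ex[].
(* Solving [z = y + tau (x - y)] for [x] gives the weight [1 - tau^-1] on [y]. *)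
exists (f tau), (1 - tau^-1); split => //.
- have : tau^-1 <= 1 by rewrite invf_le1 // (lt_le_trans ltr01).
  have : 0 <= tau^-1 by rewrite invr_ge0 (le_trans ler01).
  lra.
- apply/rowP => i; rewrite !mxE; field.
  by rewrite gt_eqF // (lt_le_trans ltr01).
- rewrite /f addrAC subrr add0r normrZ ler_wpM2r // ger0_norm //.
  exact: le_trans tau1.
Unshelve. all: by end_near. Qed.

Lemma condB_locally_conical C h : convex_set_Rn C -> compact C ->
  C° !=set0 -> convex_on C h -> essentially_smooth C h ->
  {within C, continuous h} -> condB C h -> locally_conical C.
Proof.
move=> cC kC [c Cc] ch es hc B y Cy; apply: contrapT => nlc.
(* With [e / 4], the exit point is within [e / 2] of [y], and the chosen interior point within
   [e / 4] of the exit point. *)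
have far e : 0 < e -> exists u, [/\ C° u, `|y - u| < e & 1 < bregman h y u].
  move=> e0; have e40 : 0 < e / 4 by exact: divr_gt0.
  have [x [xe Cx nCx]] : exists x, [/\ `|y - x| < e / 4, C x & ~ C (2 *: x - y)].
    apply: contrapT => nx; apply: nlc; apply/nbhs_ballP; exists (e / 4) => //= x.
    rewrite -ball_normE /= => xe Cx; apply: contrapT => nCx.
    by apply: nx; exists x.
  (* [x] may lie on the boundary; interior points close to it still have their reflection outside
     [C], because [C] is closed. *)
  have Cu k : C° (approach c x k) by exact: interior_approach.
  have ux : approach c x @ \oo --> x by exact: cvg_approach.
  have near_e : \forall k \near \oo, `|y - approach c x k| < e / 4.
    have : `|y - approach c x k| @[k --> \oo] --> `|y - x|.
      by apply: cvg_norm; apply: cvgB => //; exact: cvg_cst.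
    by move=> /cvgr_lt; exact.
  have near_C : \forall k \near \oo, ~ C (2 *: approach c x k - y).
    have u2 : 2 *: approach c x k - y @[k --> \oo] --> 2 *: x - y.
      by apply: cvgB; [exact: cvgZl_tmp|exact: cvg_cst].
    apply: (u2 (~` C)); apply: (@open_nbhs_nbhs _ _ (~` C)); split => //.
    by apply: closed_openC; exact: compact_closed.
  have [k [uxe nCu]] := filter_ex (filterI near_e near_C).
  have [z [a [Cz nCz a01 uE zy]]] := exit_point C _ y kC nCu (Cu k).
  have Cazi : C° (a *: y + (1 - a) *: z) by rewrite -uE.
  have big := bregman_gt1_approach _ _ _ _ _ cC kC ch es hc Cy Cz nCz a01 Cazi.
  have near_z := cvgr_dist_lt _ _ (cvg_approach (a *: y + (1 - a) *: z) z) _ e40.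
  have [j [Dj zj]] := filter_ex (filterI big (near_z _)).
  exists (approach (a *: y + (1 - a) *: z) z j); split => //.
    exact: interior_approach.
  rewrite -[y - _](subrKA z) (le_lt_trans (ler_normD _ _)) //.
  move: zy uxe zj; rewrite (distrC z y) (distrC (approach c x k)); lra.
have /choice[u hu] : forall k, exists u,
    [/\ C° u, `|y - u| < harmonic k & 1 < bregman h y u].
  by move=> k; apply: far; rewrite invr_gt0.
have uy : u @ \oo --> y.
  apply/cvgrPdist_le => e e0.
  near=> k; have [_ uk _] := hu k; rewrite ltW // (lt_trans uk) //.
  by near: k; exact: (cvgr_lt _ (@cvg_harmonic R)).
have Du : bregman h y (u k) @[k --> \oo] --> 0.
  by apply: B => // k; have [] := hu k.
have [k Dk] := filter_ex (cvgr_lt _ Du _ ltr01).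
by have [_ _] := hu k; rewrite ltNge (ltW Dk).
Unshelve. all: by end_near. Qed.

End Bregman.

Theorem theorem1 (R : realType) (n : nat) (C : set 'rV[R]_n) (h : 'rV[R]_n -> R) :
  convex_set_Rn C -> compact C -> interior C !=set0 ->
  legendre C h -> {within C, continuous h} ->
  (condA C h <-> strictly_convex_on C h) /\ (condB C h <-> polytope C).
Proof.
move=> cC kC C0 [ch [es _]] hc; have [[dh _] _] := es.
split; split.
- exact: condA_strictly_convex.
- exact: strictly_convex_condA.
- move=> B; apply: locally_conical_polytope => //.
  exact: condB_locally_conical hc B.
- by move=> /polytope_locally_conical; exact: locally_conical_condB.
Qed.
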